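(* Let $\lambda$ be an infinite cardinal with $\lambda\to(\lambda)^2_2$, i.e., $\lambda$ is weakly compact or $\lambda=\aleph_0$. Then there is a unique precomplete clone on $\lambda$ which contains all unary functions and is heavily binary.
   Context: $\mathscr{O}^{(n)}$ is the set of all functions $\lambda^n\to\lambda$ ($n\ge1$), $\mathscr{O}=\bigcup_{n\ge1}\mathscr{O}^{(n)}$. A clone on $\lambda$ is a set $\mathscr{C}\subseteq\mathscr{O}$ containing all projections $\pi^n_k(x_1,\dots,x_n)=x_k$ and closed under composition (if $f_1,\dots,f_k\in\mathscr{C}$ are $n$-ary and $g\in\mathscr{C}$ is $k$-ary, then $g(f_1,\dots,f_k)\in\mathscr{C}$). A clone $\mathscr{C}\neq\mathscr{O}$ is precomplete if the only clone properly containing it is $\mathscr{O}$. The relation $\lambda\to(\lambda)^2_2$ says: for every $h:[\lambda]^2\to\{0,1\}$ (where $[\lambda]^2$ is the set of 2-element subsets of $\lambda$) there is $S\subseteq\lambda$ with $|S|=\lambda$ such that $h\restriction[S]^2$ is constant; an uncountable such $\lambda$ is called weakly compact. A function $H:\lambda^2\to\lambda$ depends heavily on its first coordinate if there is $b\in\lambda$ such that $\{H(x,b):x\in\lambda\}$ has cardinality $\lambda$, and depends heavily on its second coordinate if there is $a\in\lambda$ such that $\{H(a,y):y\in\lambda\}$ has cardinality $\lambda$. A set $\mathscr{C}\subseteq\mathscr{O}$ is heavily binary if there is a binary $H\in\mathscr{C}$ that depends heavily on both coordinates. *)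

(* Defs.v *)
From mathcomp Require Import all_boot all_classical.

Set Implicit Arguments.
Unset Strict Implicit.
Unset Printing Implicit Defensive.

Local Open Scope classical_set_scope.
Local Open Scope card_scope.

(* A cardinal is represented by an arbitrary type [T] of that cardinality. *)

(* The arity is at least 1, so [op T n] is the type of (n+1)-ary operations. *)
Definition op (T : Type) (n : nat) : Type := ('I_n.+1 -> T) -> T.

Definition ops (T : Type) : Type := {n : nat & op T n}.

Definition mkop (T : Type) (n : nat) (f : op T n) : ops T := existT (op T) n f.

Definition proj_op (T : Type) (n : nat) (k : 'I_n.+1) : op T n := fun x => x k.

Definition comp_op (T : Type) (k n : nat) (g : op T k) (f : 'I_k.+1 -> op T n) :
  op T n := fun x => g (fun i => f i x).

Definition binary_op (T : Type) (H : T -> T -> T) : op T 1 :=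
  fun x => H (x ord0) (x ord_max).

Definition clone (T : Type) (C : set (ops T)) : Prop :=
  (forall (n : nat) (k : 'I_n.+1), C (mkop (@proj_op T n k))) /\
  (forall (k n : nat) (g : op T k) (f : 'I_k.+1 -> op T n),
     C (mkop g) -> (forall i, C (mkop (f i))) -> C (mkop (comp_op g f))).

Definition precomplete (T : Type) (C : set (ops T)) : Prop :=
  [/\ clone C, C <> [set: ops T] &
      forall D : set (ops T), clone D -> C `<` D -> D = [set: ops T]].

Definition contains_unary (T : Type) (C : set (ops T)) : Prop :=
  forall f : op T 0, C (mkop f).

Definition heavy_fst (T : Type) (H : T -> T -> T) : Prop :=
  exists b : T, range (fun x => H x b) #= [set: T].

Definition heavy_snd (T : Type) (H : T -> T -> T) : Prop :=
  exists a : T, range (fun y => H a y) #= [set: T].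

Definition heavily_binary (T : Type) (C : set (ops T)) : Prop :=
  exists H : T -> T -> T,
    [/\ C (mkop (binary_op H)), heavy_fst H & heavy_snd H].

Definition pairs (T : Type) (S : set T) : set (set T) :=
  [set A | A `<=` S /\ A #= `I_2].

(* Only the values of the colouring [h] on two-element sets matter. *)
Definition ramsey_pairs (T : Type) : Prop :=
  forall h : set T -> bool,
    exists S : set T, S #= [set: T] /\
      exists c : bool, forall A, pairs S A -> h A = c.

(* Main.v *)
Require Import Defs.
From mathcomp Require Import all_boot all_classical.

Set Implicit Arguments.
Unset Strict Implicit.
Unset Printing Implicit Defensive.

Local Open Scope classical_set_scope.
Local Open Scope card_scope.

(** Write [lambda] for the cardinality of [T]; a subset is large when it has
cardinality [lambda] and small otherwise.  Fix a well-order of [T] in which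
all proper initial segments are small, and say that a binary [c] is injective
on the pairs of [A] when [(x, y) |-> c x y] is injective on the [x < y] in [A].
The unique clone is the set [preservers] of all operations [f] such that
[f (c_1, .., c_n)] is injective on the pairs of no large set whenever none of
the binary functions [c_i] is injective on the pairs of a large set.  As the
set of operations that preserve a set of binary functions, it is a clone; it
contains the unary functions, omits any function that is injective on pairs,
and contains the heavy function that returns its other argument when one of
its arguments is a base point, and the base point otherwise.

Everything else follows from [clone_full]: a heavily binary clone [D] that
contains the unary functions and is not included in [preservers] contains all
operations.  This makes [preservers] maximal, and puts every other precomplete
clone of the kind considered inside it, hence equal to it.

The combinatorial core of [clone_full] is the canonical form of binary functions
[canonical_pairs]: on the pairs of some large subset, a binary function is
injective, or depends on its first argument only, or on its second only.
Usually this is deduced from the partition relation for quadruples.  Here pairs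
suffice, thanks to three consequences of the partition relation for pairs:
[lambda] is regular ([small_bigcup]); a large set can be made free for any small
set mapping of three arguments ([free_set]); and any [lambda] many subsets of
[T] are simultaneously decided, up to small sets, by one large set
([decide_family]).

Given [f] in [D] and outside [preservers], the functions [c_i] that witness the
latter become, on the pairs of a large set [B], unary functions of one of the
two arguments.  So [D] contains a binary [p] that is injective on the pairs of
[B], and only the values [p x y] with [y < x] are uncontrolled.  By the
canonical form, they are either injective too, in which case [p] is injective on
a product of two disjoint large sets, or given by a unary function [u].  In the
latter case a unary function recognises the values of [u], and the heavy function
of [D] combines [p x y] with [p y x], ignoring the one of the two that is a
value of [u].  In both cases [D] contains a pairing function, hence, with the
unary functions, every operation ([clone_pairing_full]). *)

(** * Large and small sets *)

(** Large sets are handled through injections of the whole type, which compose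
and restrict without casts. *)
Definition large (T : Type) (A : set T) : Prop :=
  exists2 f : T -> T, injective f & forall x, A (f x).

Definition small (T : Type) (A : set T) : Prop := ~ large A.

Lemma largeP (T : Type) (A : set T) : large A <-> A #= [set: T].
Proof.
split=> [[f f_inj fA]|/card_bijP[f [g fK gK]]].
  apply: Cantor_Bernstein; first exact: card_leT.
  have rangef : range f #= [set: T] by apply: inj_card_eq => x y _ _ /f_inj.
  by rewrite -(card_le_eql rangef); apply: subset_card_le => _ [x _ <-].
exists (fun x => val (g (to_setT x))).
  by move=> x y /val_inj/(can_inj gK)/(congr1 val).
by move=> x; apply: set_valP.
Qed.

Lemma large_sub (T : Type) (A B : set T) : A `<=` B -> large A -> large B.
Proof. by move=> AB [f f_inj fA]; exists f => // x; apply/AB/fA. Qed.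

Lemma small_sub (T : Type) (A B : set T) : A `<=` B -> small B -> small A.
Proof. by move=> AB sB /(large_sub AB). Qed.

Lemma largeT (T : Type) : large [set: T].
Proof. by exists id. Qed.

Lemma large_image (T : Type) (A : set T) (f : T -> T) :
  {in A &, injective f} -> large A -> large (f @` A).
Proof.
move=> f_inj [g g_inj gA]; exists (f \o g) => [x y /= e|x].
  by apply/g_inj/f_inj => //; rewrite inE.
by exists (g x).
Qed.

Lemma finite_small (T : Type) (A : set T) :
  infinite_set [set: T] -> finite_set A -> small A.
Proof.
move=> infT [n An] /largeP/card_esym AT; apply: infT; exists n.
exact: card_eq_trans AT An.
Qed.

(** * Well-orders of initial type *)

Definition initial_wo (T : Type) (lt : T -> T -> Prop) : Prop :=
  [/\ well_founded lt,
      forall x y z, lt x y -> lt y z -> lt x z,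
      forall x y, [\/ lt x y, x = y | lt y x] &
      forall x, small [set y | lt y x]].

(** Take any well-order.  If it has large initial segments, the least point that
bounds one gives a large segment, all of whose proper initial segments are
small; pull the order back along an injection into that segment. *)
Lemma exists_initial_wo (T : Type) : exists lt : T -> T -> Prop, initial_wo lt.
Proof.
have [R woR] := wochoice.well_ordering_principle {classic T}.
have woE (P : set T) : P !=set0 -> exists2 x, P x & forall y, P y -> R x y.
  move=> [z Pz].
  have [|x [[xP xmin] _]] := woR (fun x => `[< P x >]); first by exists z; apply/asboolP.
  by exists x => [|y Py]; [apply/asboolP|apply: xmin; apply/asboolP].
have Rxx x : R x x.
  by have [|y -> yx] := woE [set x]; [exists x|apply: yx].
have Rtot x y : R x y \/ R y x.
  have [|z [->|->] zm] := woE [set x; y]; first by exists x; left.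
    by left; apply: zm; right.
  by right; apply: zm; left.
have Ranti x y : R x y -> R y x -> x = y.
  move=> Rxy Ryx.
  have [|z [_ zu]] := woR (fun z => `[< z = x \/ z = y >]).
    by exists x; apply/asboolP; left.
  have zx : z = x.
    by apply: zu; split=> [|t /asboolP[->|->]] //; apply/asboolP; left.
  have zy : z = y.
    by apply: zu; split=> [|t /asboolP[->|->]] //; apply/asboolP; right.
  by rewrite -zx -zy.
have Rtr x y z : R x y -> R y z -> R x z.
  move=> Rxy Ryz.
  have [|m mP mm] := woE [set x; y; z]; first by exists x; left; left.
  have mx : R m x by apply: mm; left; left.
  have my : R m y by apply: mm; left; right.
  have mz : R m z by apply: mm; right.
  case: mP mx my mz {mm} => [[->|->]|->] // mx my mz.
    by rewrite (Ranti _ _ Rxy mx).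
  by rewrite -(Ranti _ _ Ryz my).
pose lt0 x y := R x y /\ x <> y.
have wf0 : well_founded lt0.
  move=> x; apply: contrapT => nx.
  have [|m mP mm] := woE [set x | ~ Acc lt0 x]; first by exists x.
  apply: mP; constructor => y [Rym nym]; apply: contrapT => ny.
  by apply: nym; apply: Ranti => //; apply: mm.
have tr0 x y z : lt0 x y -> lt0 y z -> lt0 x z.
  move=> [Rxy nxy] [Ryz nyz]; split; first exact: Rtr Rxy Ryz.
  by move=> xz; apply: nxy; apply: Ranti => //; rewrite xz.
have tot0 x y : [\/ lt0 x y, x = y | lt0 y x].
  have [->|nxy] := pselect (x = y); first by constructor 2.
  have [Rxy|Ryx] := Rtot x y; first by constructor 1.
  by constructor 3; split=> // e; apply: nxy.
have [small0|] := pselect (forall x, small [set y | lt0 y x]).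
  by exists lt0.
move=> /existsNP[a0 /contrapT large0].
have [|a /= large_a a_min] := woE [set a | large [set y | lt0 y a]]; first by exists a0.
have [f f_inj fa] := large_a.
exists (fun x y => lt0 (f x) (f y)); split.
- move=> x; move: {2}(f x) (erefl (f x)) => z.
  elim/(well_founded_ind wf0): z x => z IH x fxz; constructor => y fyx.
  by apply: IH (erefl _); rewrite -fxz.
- by move=> x y z; apply: tr0.
- by move=> x y; case: (tot0 (f x) (f y)) => [|/f_inj|] ?;
    [constructor 1|constructor 2|constructor 3].
- move=> x [g g_inj gx].
  have /a_min : large [set y | lt0 y (f x)].
    by exists (f \o g) => // u v /f_inj/g_inj.
  by have [Rfa nfa] := fa x => Raf; apply: nfa; apply: Ranti.
Qed.

(** * Consequences of the partition relation *)

Section Pairs.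
Variables (T : Type) (lt : T -> T -> Prop).
Hypotheses (infT : infinite_set [set: T]) (lt_wo : initial_wo lt).

Lemma lt_wf : well_founded lt. Proof. by case: lt_wo. Qed.
Lemma lt_trans x y z : lt x y -> lt y z -> lt x z.
Proof. by case: lt_wo => _ + _ _; apply. Qed.
Lemma lt_total x y : [\/ lt x y, x = y | lt y x].
Proof. by case: lt_wo. Qed.
Lemma lt_irr x : ~ lt x x.
Proof. by elim/(well_founded_ind lt_wf): x => x IH xx; apply: (IH x). Qed.
Lemma lt_asym x y : lt x y -> ~ lt y x.
Proof. by move=> xy /(lt_trans xy)/lt_irr. Qed.
Lemma neq_lt x y : x <> y -> lt x y \/ lt y x.
Proof. by case: (lt_total x y) => [|->|]; [left| |right]. Qed.

Lemma large_neq0 (A : set T) : large A -> A !=set0.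
Proof.
move=> largeA; apply/set0P/eqP => A0.
by apply: finite_small largeA => //; rewrite A0; apply: finite_set0.
Qed.

Definition le x y := ~ lt y x.

Lemma leE x y : le x y <-> lt x y \/ x = y.
Proof.
split; first by case: (lt_total x y) => [||yx /(_ yx)]; [left|right|].
by case=> [xy /(lt_asym xy)|-> /lt_irr].
Qed.
Lemma le_refl x : le x x. Proof. exact: lt_irr. Qed.
Lemma le_lt_trans x y z : le x y -> lt y z -> lt x z.
Proof. by move=> /leE[xy|->//]; apply: lt_trans. Qed.

Lemma le_trans x y z : le x y -> le y z -> le x z.
Proof.
move=> xy /leE[yz|<- //]; apply: lt_asym; exact: le_lt_trans yz.
Qed.

Definition inj_pairs (A : set T) (c : T -> T -> T) : Prop :=
  forall x y x' y', A x -> A y -> A x' -> A y' -> lt x y -> lt x' y' ->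
    c x y = c x' y' -> x = x' /\ y = y'.

Lemma inj_pairs_sub (A B : set T) c : A `<=` B -> inj_pairs B c -> inj_pairs A c.
Proof. by move=> AB Bc x y x' y' /AB + /AB + /AB + /AB; apply: Bc. Qed.

Hypothesis T_ramsey : ramsey_pairs T.

Lemma card_pair (x y : T) : x <> y -> [set x; y] #= `I_2.
Proof.
move=> xy; apply/card_set_bijP; exists (fun z => if `[< z = x >] then 0 else 1).
have yx : `[< y = x >] = false by apply/asboolPn => yx; apply: xy.
split.
- by move=> z _ /=; case: asboolP.
- move=> a b; rewrite !inE /= => -[->|->] [->|->]; rewrite ?yx ?asboolT //.
- move=> [|[|//]] _ /=; first by exists x; [left|rewrite asboolT].
  by exists y; [right|rewrite yx].
Qed.

(** The partition relation relativised to a large set, for a relation on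
increasing pairs instead of a colouring of two-element sets. *)
Lemma ramsey (A : set T) (R : T -> T -> Prop) : large A ->
  exists B, [/\ B `<=` A, large B &
    (forall x y, B x -> B y -> lt x y -> R x y) \/
    (forall x y, B x -> B y -> lt x y -> ~ R x y)].
Proof.
move=> [f f_inj fA].
pose h P := `[< exists x y, [/\ P = [set x; y], lt x y & R x y] >].
have hP x y : lt x y -> h [set x; y] = `[< R x y >].
  move=> xy; apply/asboolP/asboolP => [[x' [y' [e xy' Rxy']]]|Rxy]; last by exists x, y.
  have : [set x'; y'] x by rewrite -e; left.
  have : [set x'; y'] y by rewrite -e; right.
  case=> [yx'|yy'] [xx'|xy''].
  - by move: xy; rewrite yx' -xx' => /lt_irr.
  - by move: xy; rewrite yx' xy'' => /(lt_asym xy').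
  - by rewrite xx' yy'.
  - by move: xy; rewrite yy' -xy'' => /lt_irr.
have [S [/largeP largeS [c hS]]] := T_ramsey (fun P => h (f @` P)).
have homS x y : (f @` S) x -> (f @` S) y -> lt x y -> `[< R x y >] = c.
  move=> [s Ss <-] [t St <-] st; rewrite -(hS [set s; t]) ?image_setU ?image_set1 ?hP //.
  split=> [_ [->|->]//|]; apply: card_pair => e; apply: (@lt_irr (f s)).
  by rewrite {2}e.
exists (f @` S); split.
- by move=> _ [s _ <-].
- by apply: large_image largeS => ? ? _ _ /f_inj.
- case: c homS {hS} => homS; [left|right] => x y Sx Sy xy.
    by apply/asboolP; rewrite (homS x y).
  by apply/asboolPn; rewrite (homS x y).
Qed.

(** Regularity of the cardinal.  Send each point of the union to the index of a
piece that contains it, and colour a pair by whether the indices agree: a large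
homogeneous set would either lie in one piece or inject into the index set. *)
Lemma small_bigcup (I : set T) (F : T -> set T) :
  small I -> (forall i, I i -> small (F i)) -> small (\bigcup_(i in I) F i).
Proof.
move=> smallI smallF largeU.
have /choice[phi phiP] x : exists i, (\bigcup_(i in I) F i) x -> I i /\ F i x.
  have [[i Ii Fix]|nU] := pselect ((\bigcup_(i in I) F i) x); first by exists i.
  by exists x.
have [S [SU largeS [phiC|phiI]]] := ramsey (fun x y => phi x = phi y) largeU.
  have [x Sx] := large_neq0 largeS.
  apply: (smallF (phi x)); first by have [] := phiP x (SU x Sx).
  apply: large_sub largeS => y Sy; have [_] := phiP y (SU y Sy).
  by case: (lt_total x y) => [/phiC->|->|/phiC<-].
apply: smallI; apply: large_sub (large_image _ largeS).
  by move=> _ [x /SU/phiP[Ix _] <-]; exact: Ix.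
move=> x y; rewrite !inE => Sx Sy e.
by case: (lt_total x y) => // [/phiI|/phiI]; case.
Qed.

Lemma small1 (x : T) : small [set x].
Proof. by apply: finite_small => //; apply: finite_set1. Qed.

Lemma exists_lt : exists x y : T, lt x y.
Proof.
have [x _] := large_neq0 (largeT T).
have [y] : ~` [set x] !=set0.
  apply/set0P/eqP => x0; apply: (small1 (x := x)); apply: large_sub (largeT T) => y _.
  by apply: contrapT => yx; have : (~` [set x]) y by []; rewrite x0.
by move=> /neq_lt[]; [exists y, x|exists x, y].
Qed.

Lemma small_setU (A B : set T) : small A -> small B -> small (A `|` B).
Proof.
move=> sA sB; have [a [b ab]] := exists_lt.
pose F i := if `[< i = a >] then A else B.
have sF : small (\bigcup_(i in [set a; b]) F i).
  apply: small_bigcup => [|i _]; first by apply: finite_small => //; apply: finite_set2.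
  by rewrite /F; case: asboolP.
apply: small_sub sF => x [Ax|Bx]; first by exists a; [left|rewrite /F asboolT].
exists b; first by right.
by rewrite /F; case: asboolP => // ba; rewrite ba in ab; case: (lt_irr ab).
Qed.

Lemma small_uniq (A : set T) : (forall x y, A x -> A y -> x = y) -> small A.
Proof.
move=> A1; have [->|/set0P[x Ax]] := eqVneq A set0.
  by apply: finite_small => //; apply: finite_set0.
by apply: small_sub (small1 (x := x)) => y /A1; apply.
Qed.

Lemma small_lt x : small [set y | lt y x]. Proof. by case: lt_wo. Qed.

Lemma small_le x : small [set y | le y x].
Proof.
apply: small_sub (small_setU (@small_lt x) (small1 (x := x))) => y /leE[]; first by left.
by right.
Qed.

Lemma large_setD (A B : set T) : large A -> small B -> large (A `\` B).
Proof.
move=> largeA smallB; apply: contrapT => smallD.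
apply: small_setU smallB smallD _; apply: large_sub largeA => x Ax.
by have [?|?] := pselect (B x); [left|right].
Qed.

Lemma large_above (A : set T) x : large A -> exists2 y, A y & lt x y.
Proof.
move=> /large_setD/(_ (@small_le x))/large_neq0[y [Ay nyx]]; exists y => //.
exact: contrapT.
Qed.

(** No recursion is needed.  For [a] in [A], let [S a] be the union of the sets
[F x y z] with [x, y, z <= a], which is small by regularity, and colour a pair
[a < w] by whether [w] lies in [S a].  If [w] did so on all the pairs of a
large set, then [S a] would be large for each [a] in that set. *)
Lemma free_set (A : set T) (F : T -> T -> T -> set T) : large A ->
  (forall x y z, A x -> A y -> A z -> small (A `&` F x y z)) ->
  exists B, [/\ B `<=` A, large B & forall x y z w, B x -> B y -> B z -> B w ->
    lt x w -> lt y w -> lt z w -> ~ F x y z w].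
Proof.
move=> largeA smallF.
pose below a := A `&` [set x | le x a].
have small_below a : small (below a) by apply: small_sub (@small_le a) => x [].
pose S a := \bigcup_(x in below a) \bigcup_(y in below a) \bigcup_(z in below a)
  (A `&` F x y z).
have smallS a : small (S a).
  apply: small_bigcup => // x [Ax _]; apply: small_bigcup => // y [Ay _].
  by apply: small_bigcup => // z [Az _]; apply: smallF.
have [B [BA largeB [BS|BS]]] := ramsey (fun a w => S a w) largeA.
  have [a Ba] := large_neq0 largeB.
  case: (smallS a); apply: large_sub (large_setD largeB (@small_le a)) => w [Bw naw].
  by apply: BS => //; apply: contrapT.
exists B; split=> // x y z w Bx By Bz Bw xw yw zw Fw.
have {}BS a : B a -> lt a w -> le x a -> le y a -> le z a -> False.
  move=> Ba aw xa ya za; apply: (BS a w) => //.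
  exists x; first by split=> //; apply: BA.
  exists y; first by split=> //; apply: BA.
  by exists z; split=> //; apply: BA.
have [xy|xy] := pselect (le x y).
  have [yz|/contrapT zy] := pselect (le y z).
    by apply: (BS z) => //; [apply: le_trans yz|apply: le_refl].
  by apply: (BS y) => //; [apply: le_refl|apply: lt_asym].
have {}xy : lt y x by apply: contrapT.
have [xz|/contrapT zx] := pselect (le x z).
  by apply: (BS z) => //; [apply: le_trans xz; apply: lt_asym|apply: le_refl].
by apply: (BS x) => //; [apply: le_refl|apply: lt_asym|apply: lt_asym].
Qed.

(** Recursion on the larger element: the values used for smaller ones form a
small set by regularity, so the complement still contains a copy of [T], and
the whole of [T] may serve as the domain of the next column. *)
Lemma exists_inj_pairs : exists c, inj_pairs setT c.
Proof.
pose used y (row : forall z, lt z y -> T -> T) :=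
  [set v | exists z (zy : lt z y) x, lt x z /\ v = row z zy x].
pose good y row (f : T -> T) := injective f /\ forall x, ~ used y row (f x).
have good_ex y row : small (used y row) -> exists f, good y row f.
  by move=> /(large_setD (largeT T))[f f_inj fP]; exists f; split=> // x; case: (fP x).
(* The default [id] is never reached, since [used] turns out to be small. *)
pose step y row : T -> T :=
  if pselect (small (used y row)) is left s then projT1 (cid (good_ex y row s)) else id.
pose c := Fix lt_wf (fun _ => T -> T) step.
have cE y : c y = step y (fun z _ => c z).
  rewrite /c Fix_eq // => x f g fg; congr step.
  by apply: functional_extensionality_dep => z; apply: functional_extensionality_dep.
have c_good y : good y (fun z _ => c z) (c y).
  rewrite cE /step; case: pselect => [s|ns]; first exact: projT2 (cid (good_ex _ _ s)).
  case: ns; have : small (\bigcup_(z in [set z | lt z y]) (c z @` [set x | lt x z])).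
    apply: small_bigcup => [|z _]; first exact: small_lt.
    move=> /largeP/card_eqPle[_ le_img]; apply: (@small_lt z); apply/largeP/card_eqPle.
    by split; [exact: card_leT|exact: card_le_trans le_img (card_image_le _ _)].
  by apply: small_sub => v [z [zy [x [xz ->]]]]; exists z => //; exists x.
exists (fun x y => c y x) => x y x' y' _ _ _ _ xy xy' e.
have [yy'|yy'|yy'] := lt_total y y'.
- by have [_ /(_ x')[]] := c_good y'; exists y, yy', x.
- by subst y'; have [cI _] := c_good y; split=> //; apply: cI.
- by have [_ /(_ x)[]] := c_good y; exists y', yy', x'.
Qed.

(** When [A] and [B] overlap in a large set, two rows of a function that is
injective on pairs give disjoint large subsets of the overlap. *)
Lemma large_split (A B : set T) : large A -> large B ->
  exists A' B', [/\ A' `<=` A, B' `<=` B, large A', large B' & forall x, A' x -> ~ B' x].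
Proof.
move=> largeA largeB.
have [largeD|smallD] := pselect (large (A `\` B)).
  by exists (A `\` B), B; split=> // x [].
have [f f_inj fAB] : large (A `&` B).
  apply: large_sub (large_setD largeA smallD) => x [Ax nD]; split=> //.
  by apply: contrapT => nBx; apply: nD.
have [c c_inj] := exists_inj_pairs.
have [a [b ab]] := exists_lt.
pose row d := (fun y => f (c d y)) @` [set y | lt b y].
have rowAB d x : row d x -> A x /\ B x by move=> [y _ <-]; apply: fAB.
have large_row d : le d b -> large (row d).
  move=> db; apply: large_image => [x y|].
    rewrite !inE => bx b_y /f_inj e.
    have lt_d z : lt b z -> lt d z by apply: le_lt_trans.
    by have [] := c_inj _ _ _ _ I I I I (lt_d _ bx) (lt_d _ b_y) e.
  by apply: large_sub (large_setD (largeT T) (@small_le b)) => x [_ /contrapT].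
exists (row a), (row b); split.
- by move=> x /rowAB[].
- by move=> x /rowAB[].
- exact/large_row/lt_asym.
- exact/large_row/le_refl.
- move=> _ [y b_y <-] [z bz] /f_inj/c_inj[] // ; first exact: lt_trans b_y.
  by move=> ba; move: ab; rewrite ba => /lt_irr.
Qed.

Definition pairing (q : T -> T -> T) : Prop :=
  forall x y x' y', q x y = q x' y' -> x = x' /\ y = y'.

(** Pairs above, below and on the diagonal are coded into three disjoint copies
of [T]. *)
Lemma exists_pairing : exists q, pairing q.
Proof.
have [c c_inj] := exists_inj_pairs.
have [A [B [_ _ [f f_inj fA] largeB AB]]] := large_split (largeT T) (largeT T).
have [C [D [CB DB [g g_inj gC] [h h_inj hD] CD]]] := large_split largeB largeB.
have AC x y : f x <> g y by move=> e; apply: (AB (f x)) => //; rewrite e; apply: CB.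
have AD x y : f x <> h y by move=> e; apply: (AB (f x)) => //; rewrite e; apply: DB.
have {}CD x y : g x <> h y by move=> e; apply: (CD (g x)) => //; rewrite e.
pose q x y :=
  if `[< lt x y >] then f (c x y) else if `[< lt y x >] then g (c y x) else h x.
exists q => x y x' y'; rewrite /q.
have eqxy z t : ~ lt z t -> ~ lt t z -> z = t by case: (lt_total z t).
case: (asboolP (lt x y)) => [xy|nxy]; case: (asboolP (lt x' y')) => [xy'|nxy'].
- by move=> /f_inj/c_inj; apply.
- by case: asboolP => _; [move=> /AC|move=> /AD].
- by case: asboolP => _ /esym e; [case: (AC _ _ e)|case: (AD _ _ e)].
case: (asboolP (lt y x)) => [yx|nyx]; case: (asboolP (lt y' x')) => [yx'|nyx'].
- by move=> /g_inj/c_inj[].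
- by move=> /CD.
- by move=> /esym e; case: (CD _ _ e).
- by move=> /h_inj xx'; split=> //; rewrite -(eqxy _ _ nxy nyx) -(eqxy _ _ nxy' nyx').
Qed.

(** Each [y] determines the characteristic sequence [t |-> (y \in D t)].  A set
that is homogeneous for the lexicographic comparison of these sequences is
lexicographically monotone.  By induction on [t], coordinate [t] is constant
up to a small set along such a family: the earlier coordinates are constant up
to a small set by regularity, beyond which coordinate [t] is monotone with only
two values. *)
Lemma decide_family (A : set T) (D : T -> set T) : large A ->
  exists B, [/\ B `<=` A, large B & forall t, small (B `&` D t) \/ small (B `\` D t)].
Proof.
move=> largeA.
pose lex y z := exists t, [/\ forall s, lt s t -> D s y <-> D s z, ~ D t y & D t z].
have [B [BA largeB Blex]] := ramsey lex largeA.
exists B; split=> // t; elim/(well_founded_ind lt_wf): t => t IH.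
pose F s := if `[< small (B `&` D s) >] then B `&` D s else B `\` D s.
pose U := \bigcup_(s in [set s | lt s t]) F s.
have smallU : small U.
  apply: small_bigcup => [|s /= st]; first exact: small_lt.
  by rewrite /F; case: asboolP => // n; case: (IH s st).
have agree s y z : lt s t -> B y -> ~ U y -> B z -> ~ U z -> D s y <-> D s z.
  move=> st By nUy Bz nUz.
  have {}nUy : ~ F s y by move=> Fy; apply: nUy; exists s.
  have {}nUz : ~ F s z by move=> Fz; apply: nUz; exists s.
  move: nUy nUz; rewrite /F; case: asboolP => _ ny nz.
    by split=> Ds; [case: ny|case: nz].
  by split=> _; apply: contrapT => nD; [case: nz|case: ny].
(* Beyond [U], such a [P] is empty, or contains all that follows one of its
   elements, and what precedes that element is small. *)
have after (P : set T) :
    (forall y z, (B `\` U) y -> (B `\` U) z -> lt y z -> P y -> P z) ->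
    small (B `&` P) \/ small (B `\` P).
  move=> Pmono; have [[y BUy Py]|noP] := pselect (exists2 y, (B `\` U) y & P y).
    right; apply: small_sub (small_setU smallU (@small_le y)) => z [Bz nPz].
    have [Uz|nUz] := pselect (U z); [by left|right].
    by move=> yz; apply: nPz; apply: Pmono yz Py.
  left; apply: small_sub smallU => y [By Py]; apply: contrapT => nUy.
  by apply: noP; exists y.
case: Blex => Blex.
  apply: after => y z [By nUy] [Bz nUz] yz Dty.
  have [t' [eq_t' nDy Dz]] := Blex _ _ By Bz yz.
  have [t't|e|tt'] := lt_total t' t.
  - by case: nDy; apply/(agree t' y z).
  - by rewrite -e.
  - exact/(eq_t' _ tt').
have [] := @after (~` D t).
- move=> y z [By nUy] [Bz nUz] yz nDy Dz.
  by apply: (Blex _ _ By Bz yz); exists t; split=> // s st; apply: agree.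
- by move=> sm; right.
- by rewrite setDE setCK => sm; left.
Qed.

Lemma decide_family2 (A : set T) (D : T -> T -> set T) : large A ->
  exists B, [/\ B `<=` A, large B &
    forall s t, small (B `&` D s t) \/ small (B `\` D s t)].
Proof.
move=> largeA; have [q q_inj] := exists_pairing.
pose E i := [set z | exists s t, i = q s t /\ D s t z].
have [B [BA largeB BE]] := decide_family E largeA.
exists B; split=> // s t.
have -> : D s t = E (q s t); last exact: BE.
apply/seteqP; split=> [z Dz|z [s' [t' [/q_inj[-> ->]]]] //]; by exists s, t.
Qed.

(** * Canonical form of binary functions *)

Definition fst_on (A : set T) (c : T -> T -> T) (u : T -> T) : Prop :=
  forall x y, A x -> A y -> lt x y -> c x y = u x.
Definition snd_on (A : set T) (c : T -> T -> T) (u : T -> T) : Prop :=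
  forall x y, A x -> A y -> lt x y -> c x y = u y.

(** On a large set [B2] that decides all the equations [c x y = v] and
[c x y = c x' y] in [y], each row [c x] is almost constant or has small
fibres, and two rows are almost equal or almost disjoint as graphs.  Many
almost constant rows give a function of [x]; many almost equal rows, a function
of [y]; otherwise there are many almost disjoint rows with small fibres, which
give an injective function.  Passing to a free set removes the small
exceptions in each case. *)
Lemma canonical_pairs (A : set T) (c : T -> T -> T) : large A ->
  exists B, [/\ B `<=` A, large B &
    [\/ inj_pairs B c, exists u, fst_on B c u | exists u, snd_on B c u]].
Proof.
move=> largeA.
have [B1 [B1A largeB1 B1c]] := decide_family2 (fun x v => [set y | c x y = v]) largeA.
have [B2 [B21 largeB2 B2c]] :=
  decide_family2 (fun x x' => [set y | c x y = c x' y]) largeB1.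
have {}B1c x v : small (B2 `&` [set y | c x y = v]) \/ small (B2 `\` [set y | c x y = v]).
  by case: (B1c x v) => sm; [left|right]; apply: small_sub sm => y [/B21].
have B2A : B2 `<=` A by move=> x /B21/B1A.
pose X := B2 `&` [set x | exists v, small (B2 `\` [set y | c x y = v])].
have [largeX|smallX] := pselect (large X).
  have /choice[u uP] x : exists v, X x -> small (B2 `\` [set y | c x y = v]).
    by have [[Bx [v vP]]|nX] := pselect (X x); [exists v|exists x].
  have [B [BX largeB Bu]] := @free_set X (fun x _ _ => [set y | c x y <> u x]) largeX
    (fun x _ _ Xx _ _ => small_sub (fun y '(conj (conj By _) n) => conj By n) (uP x Xx)).
  exists B; split=> //; first by move=> x /BX[/B2A].
  constructor 2; exists u => x y Bx By xy; apply: contrapT.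
  exact: (Bu x x x y).
have largeY : large (B2 `\` X) := large_setD largeB2 smallX.
have Yc x v : (B2 `\` X) x -> small (B2 `&` [set y | c x y = v]).
  by move=> [Bx nXx]; case: (B1c x v) => // sm; case: nXx; split=> //; exists v.
have [Z [ZY largeZ [Zc|Zc]]] :=
  ramsey (fun x x' => small (B2 `\` [set y | c x y = c x' y])) largeY.
  pose F x x' (_ : T) := [set y | lt x x' /\ c x y <> c x' y].
  have [|B [BZ largeB BF]] := @free_set Z F largeZ.
    move=> x x' x'' Zx Zx' _.
    have [xx'|nxx'] := pselect (lt x x'); last first.
      by apply: small_sub (small1 (x := x)) => y [_ []].
    by apply: small_sub (Zc _ _ Zx Zx' xx') => y [/ZY[By _] [_]].
  exists B; split=> //; first by move=> x /BZ/ZY[/B2A].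
  constructor 3.
  have /choice[u uP] y : exists v, forall x, B x -> B y -> lt x y -> c x y = v.
    have [[x0 [Bx0 x0y]]|no] := pselect (exists x, B x /\ lt x y); last first.
      by exists y => x Bx _ xy; case: no; exists x.
    exists (c x0 y) => x Bx By xy; apply: contrapT => ne.
    case: (lt_total x x0) => [xx0|e|x0x].
    - by apply: (BF x x0 x0 y).
    - by rewrite e in ne.
    - by apply: (BF x0 x x y) => //; split=> // e; apply: ne.
  by exists u => x y Bx By xy; apply: uP.
pose F x x' y := [set z | c x z = c x' y] `|` [set z | lt x x' /\ c x z = c x' z].
have [|B [BZ largeB BF]] := @free_set Z F largeZ.
  move=> x x' y Zx Zx' _; apply: (small_sub (B := (B2 `&` [set z | c x z = c x' y]) `|`
    (B2 `&` [set z | lt x x' /\ c x z = c x' z]))).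
    by move=> z [/ZY[Bz _]] [?|?]; [left|right].
  apply: small_setU; first exact/Yc/ZY.
  have [xx'|nxx'] := pselect (lt x x'); last first.
    by apply: small_sub (small1 (x := x)) => z [_ []].
  have [sm|sm] := B2c x x'; first by apply: small_sub sm => z [Bz []].
  by case: (Zc _ _ Zx Zx' xx').
exists B; split=> //; first by move=> x /BZ/ZY[/B2A].
constructor 1 => x y x' y' Bx By Bx' By' xy xy' e.
have [yy'|yy'|yy'] := lt_total y y'.
- by case: (BF x' x y y') => //; [apply: lt_trans yy'|left].
- subst y'; split=> //; have [xx'|//|xx'] := lt_total x x'.
    by case: (BF x x' x' y) => //; right.
  by case: (BF x' x x y) => //; right.
- by case: (BF x x' y' y) => //; [apply: lt_trans yy'|left].
Qed.

Lemma homogeneous_values (A : set T) (g : T -> T) : large A ->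
  exists B, [/\ B `<=` A, large B &
    {in B &, injective g} \/ (forall x y, B x -> B y -> g x = g y)].
Proof.
move=> /(ramsey (fun x y => g x = g y))[B [BA largeB Bg]]; exists B; split=> //.
case: Bg => Bg; [right=> x y Bx By|left=> x y; rewrite !inE => Bx By e].
  by have [/(Bg _ _ Bx By)|->|/(Bg _ _ By Bx)] := lt_total x y.
by have [/(Bg _ _ Bx By)|//|/(Bg _ _ By Bx)/(_ (esym e))] := lt_total x y.
Qed.

(** The function [g] may be taken constant or injective.  Either way, each value
[g z] occurs at most once in a row of [p], and a free set avoids the
coincidences with [z] below [y].  If [g] is constant this covers all [z]; if it
is injective, the [z] above [y] are avoided likewise, and [p x y = g y] cannot
hold on all pairs because [p] is injective. *)
Lemma avoid_values (A : set T) (p : T -> T -> T) (g : T -> T) :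
  large A -> inj_pairs A p -> exists B, [/\ B `<=` A, large B &
    forall x y z, B x -> B y -> B z -> lt x y -> p x y <> g z].
Proof.
move=> /(homogeneous_values g)[A1 [A1A largeA1 gA1]] p_inj.
pose F x z (_ : T) := [set y | lt x y /\ p x y = g z].
have [|B [BA1 largeB BF]] := @free_set A1 F largeA1.
  move=> x z t Ax _ _; apply: small_uniq => y y' [Ay [xy e]] [Ay' [xy' e']].
  have /A1A{}Ax := Ax; have /A1A{}Ay := Ay; have /A1A{}Ay' := Ay'.
  by have [] := p_inj _ _ _ _ Ax Ay Ax Ay' xy xy' (etrans e (esym e')).
have BA : B `<=` A by move=> x /BA1/A1A.
case: gA1 => gB; last first.
  exists B; split=> // x y z Bx By Bz xy; rewrite (gB z x) => [e||]; try exact: BA1.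
  by apply: (BF x x x y).
pose G x y (_ : T) := [set z | p x y = g z].
have [|C [CB largeC CG]] := @free_set B G largeB.
  move=> x y t _ _ _; apply: small_uniq => z z' [Bz e] [Bz' e'].
  by apply: gB; rewrite ?inE; [exact: BA1|exact: BA1|rewrite -e -e'].
have [E [EC largeE Ep]] := ramsey (fun x y => p x y = g y) largeC.
have EB : E `<=` B by move=> x /EC/CB.
exists E; split=> //; first by move=> x /EB/BA.
move=> x y z Ex Ey Ez xy e; have [zy|zy|zy] := lt_total z y.
- by apply: (BF x z x y) => //; exact: EB.
- subst z; case: Ep => Ep; last exact: (Ep x y).
  have [w Ew yw] := large_above y largeE.
  have xw := lt_trans xy yw.
  have EA : E `<=` A by move=> t /EB/BA.
  have e' := etrans (Ep _ _ Ey Ew yw) (esym (Ep _ _ Ex Ew xw)).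
  have [yx _] := p_inj _ _ _ _ (EA _ Ey) (EA _ Ew) (EA _ Ex) (EA _ Ew) yw xw e'.
  by rewrite yx in xy; case: (lt_irr xy).
- by apply: (CG x y x z) => //; try exact: EC; apply: lt_trans zy.
Qed.

(** * Generating all operations *)

(** The row and the column of [H] with many values are made injective and
disjoint by unary functions, so that a value of [H] on either line tells both
the line and the point. *)
Lemma separate_heavy (H : T -> T -> T) : heavy_fst H -> heavy_snd H ->
  exists a b (l r : T -> T), [/\ injective (fun v => H (l v) b),
    injective (fun v => H a (r v)) & forall v w, H (l v) b <> H a (r w)].
Proof.
move=> [b /largeP largeb] [a /largeP largea].
have [A [B [Ab Ba [f f_inj fA] [g g_inj gB] AB]]] := large_split largeb largea.
have /choice[l lP] v : exists x, H x b = f v by have [x _] := Ab _ (fA v); exists x.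
have /choice[r rP] v : exists x, H a x = g v by have [x _] := Ba _ (gB v); exists x.
exists a, b, l, r; split=> [v w|v w|v w]; rewrite ?lP ?rP.
- exact: f_inj.
- exact: g_inj.
- by move=> e; apply: (AB (f v)) => //; rewrite e.
Qed.

Section Generation.
Variable D : set (ops T).
Hypotheses (D_clone : clone D) (D_unary : contains_unary D).

Lemma clone_apply2 n (H : T -> T -> T) (f g : op T n) :
  D (mkop (binary_op H)) -> D (mkop f) -> D (mkop g) ->
  D (mkop (fun x => H (f x) (g x))).
Proof.
move=> DH Df Dg.
have := D_clone.2 _ _ _ (fun i : 'I_2 => if i == ord0 then f else g) DH.
by apply=> i; case: ifP.
Qed.

Lemma clone_apply1 n (u : T -> T) (f : op T n) :
  D (mkop f) -> D (mkop (fun x => u (f x))).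
Proof.
by move=> Df; apply: (D_clone.2 _ _ (fun x => u (x ord0)) (fun=> f)).
Qed.

Lemma clone_coord n (u : T -> T) (k : 'I_n.+1) :
  D (mkop (fun x : 'I_n.+1 -> T => u (x k))).
Proof. by apply: clone_apply1; apply: D_clone.1. Qed.

(** Iterating the pairing codes all the arguments of an operation into one
element of [T], and a unary function decodes it. *)
Lemma clone_pairing_full q : pairing q -> D (mkop (binary_op q)) -> D = [set: ops T].
Proof.
move=> qP Dq; apply/seteqP; split=> // -[n f] _.
have [J DJ J_inj] : exists2 J : op T n, D (mkop J) & injective J.
  suff /(_ n)[J DJ JP] : forall m, exists2 J : op T n, D (mkop J) &
      forall x y, J x = J y -> forall i : 'I_n.+1, i <= m -> x i = y i.
    exists J => // x y /JP xy; apply/funext => i; apply: xy.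
    by rewrite -ltnS.
  elim=> [|m [J DJ JP]].
    exists (fun x => x ord0) => [|x y xy i]; first exact: D_clone.1.
    by rewrite leqn0 => /eqP i0; have -> : i = ord0 by apply: val_inj.
  exists (fun x => q (J x) (x (inord m.+1))).
    by apply: clone_apply2 => //; apply: D_clone.1.
  move=> x y /qP[/JP xy xym] i; rewrite leq_eqVlt => /orP[/eqP im|]; last exact: xy.
  by move: xym; rewrite -im inord_val.
have /choice[u uP] t : exists v, forall x, J x = t -> f x = v.
  have [[x xt]|no] := pselect (exists x, J x = t).
    by exists (f x) => y yt; congr f; apply: J_inj; rewrite yt.
  by exists t => x xt; case: no; exists x.
have -> : f = (fun x => u (J x)) by apply/funext => x; apply: uP.
exact: clone_apply1.
Qed.

(** Only a binary function that is injective for [x], [y] in two disjoint large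
sets is needed, whence the inequalities in the intermediate claim.  They rule
out pairs, one increasing and one decreasing, that share their larger
element. *)
Lemma clone_pairing_of_inj_pairs (H p : T -> T -> T) (A : set T) :
  D (mkop (binary_op H)) -> heavy_fst H -> heavy_snd H ->
  D (mkop (binary_op p)) -> large A -> inj_pairs A p ->
  exists2 q, pairing q & D (mkop (binary_op q)).
Proof.
move=> DH H1 H2 Dp largeA p_inj.
suff [B [q [largeB Dq qP]]] : exists B q, [/\ large B, D (mkop (binary_op q)) &
    forall x y x' y', B x -> B y -> B x' -> B y' ->
    x <> y -> x' <> y' -> y <> x' -> y' <> x ->
    q x y = q x' y' -> x = x' /\ y = y'].
  have [C [E [CB EB [f f_inj fC] [g g_inj gE] CE]]] := large_split largeB largeB.
  have {}CE v w : f v <> g w by move=> e; apply: (CE (f v)) => //; rewrite e.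
  exists (fun x y => q (f x) (g y)).
    move=> x y x' y' e.
    have BC v : B (f v) by apply: CB.
    have BE v : B (g v) by apply: EB.
    have EC v w : g v <> f w := nesym (CE w v).
    have [] := qP _ _ _ _ (BC x) (BE y) (BC x') (BE y')
      (CE _ _) (CE _ _) (EC _ _) (EC _ _) e.
    by move=> /f_inj -> /g_inj ->.
  by apply: (clone_apply2 Dq); [apply: (@clone_coord 1 f)|apply: (@clone_coord 1 g)].
pose p' x y := p y x.
have [B [BA largeB Bp']] := canonical_pairs p' largeA.
have [[u Bu]|p'_inj] : (exists u, forall x y,
    B x -> B y -> lt x y -> p' x y = u x \/ p' x y = u y)
  \/ inj_pairs B p'.
  case: Bp' => [?|[u Bu]|[u Bu]]; first by right.
    by left; exists u => x y Bx By xy; left; apply: Bu.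
  by left; exists u => x y Bx By xy; right; apply: Bu.
- have [C [CB largeC Cpu]] := avoid_values u largeB (inj_pairs_sub BA p_inj).
  have [a [b [l [r [l_inj r_inj lr]]]]] := separate_heavy H1 H2.
  (* The values [p x y] with [y < x] in [C] all lie in [V], those with [x < y] do
     not; [l'] and [r'] send [V] to the base points of the two heavy lines. *)
  pose V := u @` C.
  pose l' v := if `[< V v >] then a else l v.
  pose r' v := if `[< V v >] then b else r v.
  exists C, (fun x y => H (l' (p x y)) (r' (p y x))); split=> //.
    apply: (clone_apply2 DH); apply: clone_apply1.
      exact: Dp.
    by apply: (clone_apply2 Dp); apply: D_clone.1.
  have CA : C `<=` A by move=> x /CB/BA.
  have up x y : C x -> C y -> lt x y -> ~ V (p x y) /\ V (p y x).
    move=> Cx Cy xy; split; first by move=> [z Cz e]; apply: (Cpu x y z).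
    by case: (Bu _ _ (CB _ Cx) (CB _ Cy) xy); rewrite /p' => ->; [exists x|exists y].
  have qlt x y : C x -> C y -> lt x y -> H (l' (p x y)) (r' (p y x)) = H (l (p x y)) b.
    by move=> Cx Cy xy; have [n v] := up _ _ Cx Cy xy; rewrite /l' /r' asboolF ?asboolT.
  have qgt x y : C x -> C y -> lt y x -> H (l' (p x y)) (r' (p y x)) = H a (r (p y x)).
    by move=> Cx Cy yx; have [n v] := up _ _ Cy Cx yx; rewrite /l' /r' asboolT ?asboolF.
  move=> x y x' y' Cx Cy Cx' Cy' /neq_lt[xy|yx] /neq_lt[xy'|yx'] _ _.
  + by rewrite !qlt // => /l_inj/p_inj; apply; try exact: CA.
  + by rewrite qlt // qgt // => /lr.
  + by rewrite qgt // qlt // => /esym/lr.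
  + by rewrite !qgt // => /r_inj/p_inj[] //; exact: CA.
(* Both orientations of [p] being injective, coincidences between them whose
   larger elements differ are removed by passing to a free set. *)
pose F x y x' := [set y' | lt x y /\ lt x' y' /\ p x y = p' x' y'] `|`
  [set y' | lt x y /\ lt x' y' /\ p' x y = p x' y'].
have [|C [CB largeC CF]] := @free_set B F largeB.
  move=> x y x' Bx By Bx'; apply: (small_sub (B :=
      (B `&` [set y' | lt x' y' /\ p x y = p' x' y']) `|`
      (B `&` [set y' | lt x' y' /\ p' x y = p x' y']))).
    by move=> y' [By' [[_ [? ?]]|[_ [? ?]]]]; [left|right].
  apply: small_setU; apply: small_uniq => y1 y2 [B1 [lt1 e1]] [B2 [lt2 e2]].
    by have [] := p'_inj _ _ _ _ Bx' B1 Bx' B2 lt1 lt2 (etrans (esym e1) e2).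
  by have [] := p_inj _ _ _ _ (BA _ Bx') (BA _ B1) (BA _ Bx') (BA _ B2) lt1 lt2
    (etrans (esym e1) e2).
exists C, p; split=> //.
have CA : C `<=` A by move=> x /CB/BA.
have mixed x y x' y' : C x -> C y -> C x' -> C y' -> lt x y -> lt x' y' -> y <> y' ->
    p x y <> p' x' y'.
  move=> Cx Cy Cx' Cy' xy xy' /neq_lt[yy'|yy'] e.
    by apply: (CF x y x' y') => //; [apply: lt_trans yy'|left].
  by apply: (CF x' y' x y) => //; [apply: lt_trans yy'|right].
move=> x y x' y' Cx Cy Cx' Cy' /neq_lt[xy|yx] /neq_lt[xy'|yx'] yx1 xy1 e.
- by apply: p_inj xy xy' e; exact: CA.
- by case: (mixed x y y' x').
- by case: (mixed x' y' y x) => //; exact: nesym.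
- by have [] := p'_inj y x y' x' (CB _ Cy) (CB _ Cx) (CB _ Cy') (CB _ Cx') yx yx' e.
Qed.
End Generation.

(** * The clone of preservers *)

Definition nowhere_inj (c : T -> T -> T) : Prop :=
  forall A, large A -> ~ inj_pairs A c.

Definition preservers : set (ops T) := [set o : ops T |
  forall c : 'I_(projT1 o).+1 -> T -> T -> T, (forall i, nowhere_inj (c i)) ->
    nowhere_inj (fun x y => projT2 o (fun i => c i x y))].

Lemma preservers_clone : clone preservers.
Proof.
split=> [n k c /(_ k)//|k n g f /= gP fP c cP].
exact: (gP (fun j x y => f j (fun i => c i x y)) (fun j => fP j c cP)).
Qed.

Lemma preservers_unary : contains_unary preservers.
Proof.
move=> f c cP A largeA fc_inj; apply: (cP ord0 A largeA).
move=> x y x' y' Ax Ay Ax' Ay' xy xy' e; apply: fc_inj => //=.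
by congr f; apply/funext => i; rewrite ord1.
Qed.

Lemma fst_on_not_inj (A : set T) (c : T -> T -> T) u :
  large A -> fst_on A c u -> ~ inj_pairs A c.
Proof.
move=> largeA cu c_inj; have [x Ax] := large_neq0 largeA.
have [y Ay xy] := large_above x largeA; have [z Az yz] := large_above y largeA.
have xz := lt_trans xy yz.
have [_ e] := c_inj _ _ _ _ Ax Ay Ax Az xy xz
  (etrans (cu _ _ Ax Ay xy) (esym (cu _ _ Ax Az xz))).
by move: yz; rewrite e => /lt_irr.
Qed.

Lemma snd_on_not_inj (A : set T) (c : T -> T -> T) u :
  large A -> snd_on A c u -> ~ inj_pairs A c.
Proof.
move=> largeA cu c_inj; have [x Ax] := large_neq0 largeA.
have [y Ay xy] := large_above x largeA; have [z Az yz] := large_above y largeA.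
have xz := lt_trans xy yz.
have [e _] := c_inj _ _ _ _ Ax Az Ay Az xz yz
  (etrans (cu _ _ Ax Az xz) (esym (cu _ _ Ay Az yz))).
by move: xy; rewrite e => /lt_irr.
Qed.

Lemma preservers_proper : preservers <> [set: ops T].
Proof.
move=> preservT; have [p p_inj] := exists_inj_pairs.
have : preservers (mkop (binary_op p)) by rewrite preservT.
move=> /(_ (fun i x y => if i == ord0 then x else y)) /=; apply; last first.
- exact: p_inj.
- exact: largeT.
move=> i A largeA; case: (i == ord0).
  by apply: (@fst_on_not_inj A _ id).
by apply: (@snd_on_not_inj A _ id).
Qed.

(** The function [K] combines [c1] and [c2] into one of [c1], [c2] or a constant,
according to which of them take the value [o]; by homogeneity the choice is the
same for all pairs of a large set, so [K] creates no injectivity. *)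
Lemma preservers_heavy : heavily_binary preservers.
Proof.
have [o _] := large_neq0 (largeT T).
pose K x y := if `[< y = o >] then x else if `[< x = o >] then y else o.
have Ko y : K o y = y by rewrite /K; case: asboolP => [->|] //; rewrite asboolT.
have oK x : K x o = x by rewrite /K asboolT.
exists K; split.
- move=> c cP A largeA; rewrite /= /binary_op.
  set c1 := c ord0; set c2 := c ord_max => Kc_inj.
  have [B [BA largeB Bc2]] := ramsey (fun x y => c2 x y = o) largeA.
  have KB_inj := inj_pairs_sub BA Kc_inj.
  case: Bc2 => Bc2.
    apply: (cP ord0 B largeB) => x y x' y' Bx By Bx' By' xy xy' e.
    by apply: KB_inj => //=; rewrite !Bc2 // !oK.
  have [C [CB largeC Cc1]] := ramsey (fun x y => c1 x y = o) largeB.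
  have KC_inj := inj_pairs_sub CB KB_inj.
  case: Cc1 => Cc1.
    apply: (cP ord_max C largeC) => x y x' y' Cx Cy Cx' Cy' xy xy' e.
    by apply: KC_inj => //=; rewrite !Cc1 // !Ko.
  apply: (@fst_on_not_inj C _ (fun=> o) largeC _ KC_inj) => x y Cx Cy xy.
  by rewrite /K !asboolF //; [apply: Cc1|apply: Bc2 => //; apply: CB].
- exists o; apply/largeP; exists id => // x; exists x => //; exact: oK.
- exists o; apply/largeP; exists id => // x; exists x => //; exact: Ko.
Qed.

Lemma canonical_family (I : finType) (c : I -> T -> T -> T) (A : set T) :
  large A -> (forall i, nowhere_inj (c i)) -> exists B, [/\ B `<=` A, large B &
    forall i, exists u, fst_on B (c i) u \/ snd_on B (c i) u].
Proof.
move=> largeA cP.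
suff [B [BA largeB Bc]] : exists B, [/\ B `<=` A, large B &
    forall i, i \in enum I -> exists u, fst_on B (c i) u \/ snd_on B (c i) u].
  by exists B; split=> // i; apply: Bc; rewrite mem_enum.
elim: (enum I) => [|j s [B [BA largeB Bc]]]; first by exists A; split=> // i.
have [C [CB largeC Cj]] := canonical_pairs (c j) largeB.
exists C; split=> [x /CB/BA //|//|i]; rewrite inE => /orP[/eqP ->|/Bc[u Bu]].
  by case: Cj => [/(cP j C largeC)//|[u Cu]|[u Cu]]; exists u; [left|right].
by exists u; case: Bu => Bu; [left|right] => x y /CB Bx /CB By; apply: Bu.
Qed.

(** Outside of [preservers] there is an operation [f] that creates injectivity
on pairs from functions [c i] without it.  These functions need not belong to
[D], but on a large set their canonical forms are unary functions of one
argument, and those do. *)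
Lemma clone_full (D : set (ops T)) : clone D -> contains_unary D ->
  heavily_binary D -> ~ (D `<=` preservers) -> D = [set: ops T].
Proof.
move=> D_clone D_unary [H [DH H1 H2]] /existsNP[[n f] /not_implyP[Df]].
move=> /existsNP[c /not_implyP[cP /existsNP[A /not_implyP[largeA /contrapT fc_inj]]]].
have [B [BA largeB Bc]] := canonical_family largeA cP.
have /choice[u uP] := Bc.
pose p x y := f (fun i => u i (if `[< fst_on B (c i) (u i) >] then x else y)).
have Dp : D (mkop (binary_op p)).
  pose g (i : 'I_n.+1) : op T 1 :=
    fun x => u i (x (if `[< fst_on B (c i) (u i) >] then ord0 else ord_max)).
  have -> : binary_op p = comp_op f g.
    apply/funext => x; rewrite /comp_op /binary_op /p; congr f.
    by apply/funext => i; rewrite /g; case: ifP.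
  by apply: D_clone.2 => // i; apply: (clone_coord D_clone D_unary (u i)).
have p_inj : inj_pairs B p.
  move=> x y x' y' Bx By Bx' By' xy xy' e; apply: fc_inj; try exact: BA; try by [].
  have pE z t : B z -> B t -> lt z t -> f (fun i => c i z t) = p z t.
    move=> Bz Bt zt; rewrite /p; congr f; apply/funext => i.
    by case: asboolP (uP i) => [Bu _|nBu [//|Bu]]; apply: Bu.
  by rewrite /= !pE.
have [q qP Dq] := clone_pairing_of_inj_pairs D_clone D_unary DH H1 H2 Dp largeB p_inj.
exact: clone_pairing_full qP Dq.
Qed.
End Pairs.

Theorem theorem5p4 (T : Type) (T_infinite : infinite_set [set: T])
    (T_ramsey : ramsey_pairs T) :
  exists! C : set (ops T),
    [/\ precomplete C, contains_unary C & heavily_binary C].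
Proof.
have [lt lt_wo] := exists_initial_wo T.
have full := clone_full T_infinite lt_wo T_ramsey.
have P_clone := preservers_clone lt; have P_unary := preservers_unary (lt := lt).
have P_proper := preservers_proper T_infinite lt_wo T_ramsey.
have P_heavy := preservers_heavy T_infinite lt_wo T_ramsey.
exists (preservers lt); split=> [|C [[C_clone C_proper C_max] C_unary C_heavy]].
  split=> //; split=> // D D_clone [PD nDP]; apply: full => //.
    by move=> f; apply: PD.
  by have [H [PH H1 H2]] := P_heavy; exists H; split=> //; apply: PD.
have CP : C `<=` preservers lt.
  by apply: contrapT => /(full _ C_clone C_unary C_heavy).
apply: contrapT => neq; apply: P_proper; apply: C_max => //; split=> // PC.
by apply: neq; apply/seteqP.
Qed.
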